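(* Let $(b_n)_{n\in\mathbb{N}}$ be a sequence of pairwise coprime positive integers, and define $A=\mathrm{SL}_2(\mathbb{Z})\setminus\bigcup_{n\in\mathbb{N}}\Gamma(b_n)$. Then $A$ is not piecewise syndetic in $\mathrm{SL}_2(\mathbb{Z})$.
   Context: For $n\in\mathbb{N}$, $\Gamma(n)$ denotes the subgroup of all matrices in $\mathrm{SL}_2(\mathbb{Z})$ that are congruent entrywise to the identity matrix modulo $n$. For a countably infinite semigroup $G$, $A\subseteq G$ and $g\in G$, write $g^{-1}A=\{x\in G: gx\in A\}$, and for $H\subseteq G$ write $H^{-1}A=\bigcup_{h\in H}h^{-1}A$. A set $A\subseteq G$ is (right) thick if for every finite $F\subseteq G$ there is $g\in G$ with $Fg\subseteq A$; it is (right) piecewise syndetic if there is a finite $H\subseteq G$ such that $H^{-1}A$ is thick. *)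

(* Defs.v *)
From HB Require Import structures.
From mathcomp Require Import all_boot all_order all_fingroup all_algebra.
From mathcomp Require Import classical_sets cardinality.

Set Implicit Arguments.
Unset Strict Implicit.
Unset Printing Implicit Defensive.

Import GRing.Theory.

Local Open Scope classical_set_scope.

Section Largeness.
Context {G : semigroupType}.
Implicit Types (A H F : set G) (g h : G).

Definition ltranslate_inv g A : set G := [set x | A (g * x)%g].

Definition lset_inv H A : set G := \bigcup_(h in H) ltranslate_inv h A.

(* These are the right-handed notions: finite sets are translated by an
   element acting on the right. *)
Definition thick A : Prop :=
  forall F, finite_set F -> exists g, [set (f * g)%g | f in F] `<=` A.

Definition piecewise_syndetic A : Prop :=
  exists H, finite_set H /\ thick (lset_inv H A).

End Largeness.

Section SL2Z.
Local Open Scope ring_scope.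

Record SL2Z := MkSL2Z { SL2Z_val :> 'M[int]_2; _ : \det SL2Z_val == 1 }.

HB.instance Definition _ := [isSub for SL2Z_val].
HB.instance Definition _ := [Countable of SL2Z by <:].

Lemma SL2Z_det (M : SL2Z) : \det (M : 'M[int]_2) = 1.
Proof. exact/eqP/(valP M). Qed.

Fact SL2Z_one_subproof : \det (1%:M : 'M[int]_2) == 1.
Proof. by rewrite det1. Qed.

Fact SL2Z_mul_subproof (M N : SL2Z) :
  \det ((M : 'M[int]_2) *m (N : 'M[int]_2)) == 1.
Proof. by rewrite det_mulmx !SL2Z_det mulr1. Qed.

Fact SL2Z_inv_subproof (M : SL2Z) : \det (invmx (M : 'M[int]_2)) == 1.
Proof. by rewrite det_inv SL2Z_det invr1. Qed.

Definition SL2Z_one : SL2Z := MkSL2Z SL2Z_one_subproof.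
Definition SL2Z_mul (M N : SL2Z) : SL2Z := MkSL2Z (SL2Z_mul_subproof M N).
Definition SL2Z_inv (M : SL2Z) : SL2Z := MkSL2Z (SL2Z_inv_subproof M).

Fact SL2Z_mulA : associative SL2Z_mul.
Proof. by move=> M N P; apply/val_inj/mulmxA. Qed.

Fact SL2Z_mul1 : left_id SL2Z_one SL2Z_mul.
Proof. by move=> M; apply/val_inj/mul1mx. Qed.

Fact SL2Z_mulr1 : right_id SL2Z_one SL2Z_mul.
Proof. by move=> M; apply/val_inj/mulmx1. Qed.

Fact SL2Z_unit (M : SL2Z) : (M : 'M[int]_2) \in unitmx.
Proof. by rewrite unitmxE SL2Z_det unitr1. Qed.

Fact SL2Z_mulV : left_inverse SL2Z_one SL2Z_inv SL2Z_mul.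
Proof. by move=> M; apply/val_inj/mulVmx/SL2Z_unit. Qed.

Fact SL2Z_mulrV : right_inverse SL2Z_one SL2Z_inv SL2Z_mul.
Proof. by move=> M; apply/val_inj/mulmxV/SL2Z_unit. Qed.

HB.instance Definition _ := isGroup.Build SL2Z
  SL2Z_mulA SL2Z_mul1 SL2Z_mulr1 SL2Z_mulV SL2Z_mulrV.

Definition Gamma (n : nat) : set SL2Z :=
  [set M : SL2Z | forall i j : 'I_2,
     ((M : 'M[int]_2) i j = (1%:M : 'M[int]_2) i j %[mod n%:Z])%Z].

End SL2Z.

(* Main.v *)
Require Import Defs.
From mathcomp Require Import all_boot all_order all_fingroup all_algebra.
From mathcomp Require Import classical_sets cardinality.
From mathcomp Require Import ring.

Import Order.TTheory GRing.Theory Num.Theory.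

Local Open Scope classical_set_scope.

(** Write [A] for the complement of the union of the [Gamma (b n)], and suppose
    that a finite set [H = {h_0, ..., h_(k-1)}] makes [H^-1 A] thick. The
    contradiction comes from using a different modulus for each [h_i]: given
    [g], an [f] with [f = h_i^-1 g^-1] modulo [b i] for all [i < k] makes
    [h_i f g] lie in [Gamma (b i)], hence outside [A], for every [i], so that
    [f g] is not in [H^-1 A].

    Such an [f] exists in SL2(Z) by strong approximation ([SL2Z_chinese]),
    which rests on the factorization SL2(Z) = Gamma(m) Gamma(n) for coprime
    [m] and [n] ([SL2Z_Gamma_prod]); since SL2(Z) is generated by elementary
    matrices ([SL2Z_elementary_ind]), that factorization reduces to Bezout's
    identity. Moreover [f] only matters modulo the product [N] of the [b i], so
    it can be taken in a set of representatives modulo [Gamma N], which is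
    finite ([Gamma_finite_index]) and does not depend on [g]: this set is the
    finite set that no right translation sends into [H^-1 A]. *)

(** * Congruence subgroups *)

Section Congruence.
Local Open Scope ring_scope.
Implicit Types (n : nat) (M N : SL2Z).

Lemma SL2Z_mulE M N : ((M * N)%g : 'M[int]_2) = (M : 'M[int]_2) *m N.
Proof. by []. Qed.

Lemma mxOver_dvdz_mull n (A B : 'M[int]_2) :
  B \is a mxOver (dvdz n) -> A *m B \is a mxOver (dvdz n).
Proof.
move=> /mxOverP nB; apply/mxOverP => i j; rewrite mxE.
by apply: rpred_sum => k _; apply: dvdz_mull.
Qed.

Lemma mxOver_dvdz_mulr n (A B : 'M[int]_2) :
  A \is a mxOver (dvdz n) -> A *m B \is a mxOver (dvdz n).
Proof.
move=> /mxOverP nA; apply/mxOverP => i j; rewrite mxE.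
by apply: rpred_sum => k _; apply: dvdz_mulr.
Qed.

(** Congruence to the identity modulo [n] becomes membership in the two-sided
    ideal of matrices with entries in [nZ]; the group properties of [Gamma n]
    below all come from the ideal property. *)
Lemma GammaP n M :
  Gamma n M <-> (M : 'M[int]_2) - 1%:M \is a mxOver (dvdz n).
Proof.
split=> [GM | /mxOverP nM i j].
  by apply/mxOverP => i j; rewrite !mxE -eqz_mod_dvd; have := GM i j;
    rewrite mxE => ->.
by apply/eqP; rewrite eqz_mod_dvd; have := nM i j; rewrite !mxE.
Qed.

Lemma Gamma1 n : Gamma n 1%g.
Proof. by apply/GammaP; rewrite subrr rpred0. Qed.

Lemma GammaM n M N : Gamma n M -> Gamma n N -> Gamma n (M * N)%g.
Proof.
move=> /GammaP nM /GammaP nN; apply/GammaP.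
have -> : ((M * N)%g : 'M[int]_2) - 1%:M =
    ((M : 'M[int]_2) - 1%:M) *m N + ((N : 'M[int]_2) - 1%:M).
  by rewrite SL2Z_mulE mulmxBl mul1mx addrA subrK.
by rewrite rpredD // mxOver_dvdz_mulr.
Qed.

Lemma GammaV n M : Gamma n M -> Gamma n M^-1%g.
Proof.
move=> /GammaP nM; apply/GammaP.
have -> : (M^-1%g : 'M[int]_2) - 1%:M =
    - ((M^-1%g : 'M[int]_2) *m ((M : 'M[int]_2) - 1%:M)).
  by rewrite mulmxBr mulmx1 -SL2Z_mulE mulVg opprB.
by rewrite rpredN mxOver_dvdz_mull.
Qed.

Lemma Gamma_conj n M N : Gamma n M -> Gamma n (N * M * N^-1)%g.
Proof.
move=> /GammaP nM; apply/GammaP.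
have -> : ((N * M * N^-1)%g : 'M[int]_2) - 1%:M =
    (N : 'M[int]_2) *m ((M : 'M[int]_2) - 1%:M) *m N^-1%g.
  by rewrite mulmxBr mulmxBl mulmx1 -!SL2Z_mulE mulgV.
by rewrite mxOver_dvdz_mulr // mxOver_dvdz_mull.
Qed.

Lemma Gamma_dvdn m n M : (m %| n)%N -> Gamma n M -> Gamma m M.
Proof.
move=> mn /GammaP/mxOverP nM; apply/GammaP/mxOverP => i j.
by apply: dvdz_trans (nM i j).
Qed.

(** There are finitely many matrices modulo [n], and two elements of SL2(Z)
    with the same entries modulo [n] differ by an element of [Gamma n]; so [F]
    is obtained by choosing a preimage of each matrix modulo [n] that comes
    from SL2(Z). *)
Lemma Gamma_finite_index n : (0 < n)%N ->
  exists F : set SL2Z, finite_set F /\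
    forall M, exists f, F f /\ Gamma n (f^-1 * M)%g.
Proof.
case: n => // n _.
pose red (M : SL2Z) : 'M['I_n.+1]_2 :=
  \matrix_(i, j) inord `|(M i j %% n.+1)%Z|%N.
(* For a matrix that does not lift to SL2(Z), [xget] returns the default 1. *)
exists (range (fun A => xget 1%g (red @^-1` [set A]))); split=> [|M].
  exact/finite_image/finite_finset.
pose f : SL2Z := xget 1%g (red @^-1` [set red M]).
have redf : red f = red M.
  by apply: (@xgetPex _ 1%g (red @^-1` [set red M])); exists M.
exists f; split; first by exists (red M).
apply/GammaP.
have -> : ((f^-1 * M)%g : 'M[int]_2) - 1%:M =
    (f^-1%g : 'M[int]_2) *m ((M : 'M[int]_2) - (f : 'M[int]_2)).
  by rewrite mulmxBr -!SL2Z_mulE mulVg.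
apply/mxOver_dvdz_mull/mxOverP => i j; rewrite !mxE -eqz_mod_dvd.
have modn (x : int) : exists2 r, (r < n.+1)%N & (x %% n.+1)%Z = r%:Z.
  exists `|(x %% n.+1)%Z|%N; last by rewrite gez0_abs // modz_ge0.
  by rewrite -ltz_nat gez0_abs ?modz_ge0 // ltz_pmod.
have /matrixP/(_ i j) := redf; rewrite !mxE.
have [r rn ->] := modn (f i j); have [s sn ->] := modn (M i j).
by move=> /(congr1 val); rewrite /= !inordK // => ->.
Qed.

End Congruence.

(** * Elementary matrices *)

Section Elementary.
Local Open Scope ring_scope.
Implicit Types (i j : 'I_2) (s t : int) (M N : SL2Z).

Lemma ord2P i : i = 0 \/ i = 1.
Proof. by case: i => -[|[|//]] ?; [left | right]; apply/val_inj. Qed.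

Lemma rev_ord2_neq i : (rev_ord i == i) = false.
Proof. by case: i => -[|[|]]. Qed.

Lemma det_mx22 (R : comNzRingType) (A : 'M[R]_2) :
  \det A = A 0 0 * A 1 1 - A 0 1 * A 1 0.
Proof.
rewrite (expand_det_row _ 0) !big_ord_recl big_ord0 addr0 /cofactor !det_mx11.
rewrite !mxE /= expr0 expr1 mul1r mulN1r mulrN.
by congr (_ * A _ _ - A _ _ * A _ _); apply/val_inj.
Qed.

Fact elementary_subproof i t :
  \det (1%:M + t *: delta_mx i (rev_ord i) : 'M[int]_2) == 1.
Proof.
by rewrite det_mx22 !mxE; case: i => -[|[|//]] ? /=;
  rewrite !(mulr0, mulr1, addr0, add0r, mul0r, subr0).
Qed.

(** As [rev_ord] exchanges the two indices, this covers both the upper and the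
    lower elementary matrices. *)
Definition elementary i t : SL2Z := MkSL2Z (elementary_subproof i t).

Lemma elementaryD i s t :
  elementary i (s + t) = (elementary i s * elementary i t)%g.
Proof.
apply/val_inj => /=; rewrite mulmxDl mul1mx mulmxDr mulmx1 -scalemxAl -scalemxAr.
by rewrite mul_delta_mx_0 ?rev_ord2_neq // !scaler0 addr0 scalerDl addrA addrAC.
Qed.

Lemma elementary0 i : elementary i 0 = 1%g.
Proof. by apply/val_inj; rewrite /= scale0r addr0. Qed.

Lemma elementaryN i t : elementary i (- t) = (elementary i t)^-1%g.
Proof.
apply/eqP; rewrite eq_sym -(can_eq (mulKg (elementary i t))) mulgV.
by rewrite -elementaryD subrr elementary0.
Qed.

Lemma elementary_mulE i t M k j : (elementary i t * M)%g k j =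
  M k j + (if k == i then t * M (rev_ord i) j else 0).
Proof.
rewrite SL2Z_mulE /= mulmxDl mul1mx -scalemxAl !mxE (bigD1 (rev_ord i)) //=.
rewrite big1 ?addr0 => [|l /negPf lNi]; last by rewrite mxE lNi andbF mul0r.
by rewrite mxE eqxx andbT; case: eqP; rewrite ?mul1r ?mul0r ?mulr0.
Qed.

Lemma Gamma_elementary (n : nat) i t : (n %| t)%Z -> Gamma n (elementary i t).
Proof.
move=> nt; apply/GammaP/mxOverP => k j.
by rewrite /= addrC addKr !mxE dvdz_mulr.
Qed.

(** SL2(Z) is generated by elementary matrices, in the form of an induction
    principle: Euclid's algorithm on the first column, whose row operations
    are left multiplications by elementary matrices. *)
Lemma SL2Z_elementary_ind (P : SL2Z -> Prop) : P 1%g ->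
  (forall i t M, P M -> P (elementary i t * M)%g) -> forall M, P M.
Proof.
move=> P1 PE.
have PEV i t M : P (elementary i t * M)%g -> P M.
  by move/(PE i (- t)); rewrite elementaryN mulKg.
have rev0 : rev_ord 0 = 1 :> 'I_2 by apply/val_inj.
have rev1 : rev_ord 1 = 0 :> 'I_2 by apply/val_inj.
(* The quarter turn [0 1; -1 0], which exchanges the rows up to a sign. *)
pose w M :=
  (elementary 0%R 1%R * (elementary 1%R (-1)%R * (elementary 0%R 1%R * M)))%g.
have Pw M : P (w M) -> P M by move=> /PEV/PEV/PEV.
have w0 M j : w M 0 j = M 1 j.
  by rewrite !(elementary_mulE, eqxx, rev0, rev1) /=; ring.
have w1 M j : w M 1 j = - M 0 j.
  by rewrite !(elementary_mulE, eqxx, rev0, rev1) /=; ring.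
have P_unipotent M : M 1 0 = 0 -> M 0 0 = 1 -> P M.
  move=> c0 a1; have := SL2Z_det M.
  rewrite det_mx22 c0 a1 mul1r mulr0 subr0 => d1.
  suff -> : M = (elementary 0%R (M 0 1)%R * 1)%g by apply: PE.
  rewrite mulg1; apply/val_inj/matrixP => i j /=; rewrite !mxE rev0.
  by case: (ord2P i) => ->; case: (ord2P j) => -> /=; rewrite ?c0 ?a1 ?d1; ring.
move=> M; have [n] := ubnP `|(M 1 0)%R|%N; elim: n M => // n IHn M ltMn.
have [c0 | c_neq0] := eqVneq (M 1 0) 0.
  (* The diagonal entries are both 1 or both -1, and two quarter turns
     multiply [M] by -1. *)
  have := SL2Z_det M; rewrite det_mx22 c0 mulr0 subr0 mulrC.
  move=> /intUnitRing.unitzPl/orP[] /eqP aE.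
    by apply: P_unipotent.
  by apply/Pw/Pw/P_unipotent; rewrite !(w0, w1) ?c0 ?aE ?oppr0 ?opprK.
(* One Euclidean step: the first row becomes the remainder, then the rows are
   exchanged so that the remainder is the new lower left entry. *)
apply/(PEV 0 (- ((M 0 0)%R %/ (M 1 0)%R)%Z))/Pw/IHn.
rewrite w1 elementary_mulE eqxx rev0 mulNr abszN -/(modz _ _).
apply: leq_trans (_ : `|(M 1 0)%R| <= n)%N; last by rewrite -ltnS.
by rewrite -ltz_nat !abszE ger0_norm ?modz_ge0 // ltz_mod.
Qed.

End Elementary.

(** * Strong approximation *)

(** By normality of [Gamma m], the products [Gamma m * Gamma n] form a
    subgroup; it contains every elementary matrix because [Z = mZ + nZ]. *)
Lemma SL2Z_Gamma_prod m n (M : SL2Z) : coprime m n ->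
  exists A B, [/\ Gamma m A, Gamma n B & M = (A * B)%g].
Proof.
move=> co_mn; move: M; apply: SL2Z_elementary_ind.
  by exists 1%g, 1%g; split; [exact: Gamma1 | exact: Gamma1 | rewrite mulg1].
move=> i t _ [A [B [mA nB ->]]].
have [[u v] /= uv1] : exists p : int * int, (p.1 * m + p.2 * n = 1)%R.
  have /eqP := co_mn; case: (Bezoutz m n) => u [v uv] mn1.
  by exists (u, v); rewrite uv /gcdz !absz_nat mn1.
pose X := elementary i (t * u * m)%R; pose Y := elementary i (t * v * n)%R.
have -> : elementary i t = (X * Y)%g.
  by rewrite -elementaryD -!mulrA -mulrDr uv1 mulr1.
have mX : Gamma m X by apply/Gamma_elementary/dvdz_mull.
have nY : Gamma n Y by apply/Gamma_elementary/dvdz_mull.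
exists (X * (Y * A * Y^-1))%g, (Y * B)%g; split.
- exact/GammaM/Gamma_conj.
- exact: GammaM.
- by rewrite !mulgA mulgKV.
Qed.

(** A solution [M] of the first [k] congruences remains one when multiplied on
    the right by an element of [Gamma (b 0 * ... * b (k-1))]; the first factor
    of [M^-1 * c k] in [Gamma (b 0 * ... * b (k-1)) * Gamma (b k)] is the
    correction that also solves the next one. *)
Lemma SL2Z_chinese (b : nat -> nat) (c : nat -> SL2Z) k :
    (forall m n, m <> n -> coprime (b m) (b n)) ->
  exists M, forall i, (i < k)%N -> Gamma (b i) (M^-1 * c i)%g.
Proof.
move=> b_coprime; elim: k => [|k [M MP]]; first by exists 1%g.
have co_k : coprime (\prod_(i < k) b i) (b k).
  elim/big_ind: _ => [|x y xk yk|i _]; rewrite ?coprime1n ?coprimeMl ?xk //.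
  by apply: b_coprime => ik; have := ltn_ord i; rewrite ik ltnn.
have [A [B [bA bB AB]]] := SL2Z_Gamma_prod _ _ (M^-1 * c k)%g co_k.
exists (M * A)%g => i; rewrite ltnS leq_eqVlt invMg -mulgA => /predU1P[-> | ik].
  by rewrite AB mulKg.
apply: GammaM; last exact: MP.
apply/GammaV/(Gamma_dvdn _ _ _ _ bA).
by rewrite (bigD1 (Ordinal ik)) //= dvdn_mulr.
Qed.

Theorem theorem28 (b : nat -> nat)
    (b_pos : forall n : nat, (0 < b n)%N)
    (b_coprime : forall m n : nat, m <> n -> coprime (b m) (b n)) :
  ~ piecewise_syndetic
      ([set: SL2Z] `\` \bigcup_(n in [set: nat]) Gamma (b n)).
Proof.
move=> [_ [/finite_seqP[s ->] thickHA]].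
pose h i := nth 1%g s i.
have N_gt0 : (0 < \prod_(i < size s) b i)%N by rewrite prodn_gt0.
have [F [finF FP]] := Gamma_finite_index _ N_gt0.
have [g gP] := thickHA F finF.
have [M MP] := SL2Z_chinese b (fun i => (h i)^-1 * g^-1)%g (size s) b_coprime.
have [f [Ff fM]] := FP M.
have [_ /= /(nthP 1%g)[i ltis <-] [_]] :=
  gP _ (imageP (fun f => f * g)%g Ff).
apply; exists i => //.
have bfM : Gamma (b i) (f^-1 * M)%g.
  by apply: Gamma_dvdn fM; rewrite (bigD1 (Ordinal ltis)) //= dvdn_mulr.
(* [g h_i f] lies in [Gamma (b i)], so its conjugate [h_i f g] does too. *)
have := GammaM _ _ _ bfM (MP i ltis).
rewrite !mulgA mulgK => /GammaV/(Gamma_conj _ _ g^-1%g).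
by rewrite !invMg !invgK !mulgA mulVg mul1g.
Qed.
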